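(* Fix $\tau>0$ and $\rho_1',\rho_2'\in(0,1/2)$ such that $$(1-2\rho_1')^2+(1-2\rho_2')^2>1.$$ There exists a sequence $\delta_k\to0$ such that for all $k$ and every Boolean function $\Psi:\mathbb{F}_2^k\to\{0,1\}$ with $|\mathrm{supp}\,\Psi|=n$, where $n\in[\tau k,k/\tau]$ and $h_2(\rho_1')\frac kn\le1$, we have $$\max_{\omega\in\mathbb{F}_2^k:\,|\omega|\ge\rho_2'k}\hat\Psi(\omega)\ge n\left(2\sqrt{\rho_1(1-\rho_1)}+\delta_k\right),$$ where $\rho_1=h_2^{-1}\left(h_2(\rho_1')\tfrac kn\right)$.
   Context: $h_2(\rho)=-\rho\log_2\rho-(1-\rho)\log_2(1-\rho)$ is the base-2 binary entropy and $h_2^{-1}:[0,1]\to[0,1/2]$ its functional inverse. For $\omega\in\mathbb{F}_2^k$, $|\omega|$ is the Hamming weight. The Fourier transform is $\hat\Psi(\omega)=\sum_{x\in\mathbb{F}_2^k}(-1)^{\langle\omega,x\rangle}\Psi(x)$ with $\langle\omega,x\rangle=\sum_j\omega_jx_j$. The sequence $\delta_k$ may depend on $\tau,\rho_1',\rho_2'$ but not on $\Psi$ or $n$, and its terms may be of either sign. *)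

(* Defs.v *)
From mathcomp Require Import all_boot all_order all_algebra.
From mathcomp Require Import all_classical all_reals all_analysis.

Set Implicit Arguments.
Unset Strict Implicit.
Unset Printing Implicit Defensive.

Import Order.TTheory GRing.Theory Num.Theory.
Import numFieldNormedType.Exports.

Local Open Scope classical_set_scope.
Local Open Scope ring_scope.

Definition log2 (R : realType) (x : R) : R := ln x / ln 2.

(* At the endpoints the factor in front of the logarithm vanishes, so
   h2 0 = h2 1 = 0 whatever the value of [ln 0]. *)
Definition h2 (R : realType) (rho : R) : R :=
  - rho * log2 rho - (1 - rho) * log2 (1 - rho).

(* The inverse of the restriction of [h2] to [0, 1/2]. Its values are
   meaningful on h2 @` [0, 1/2] = [0, 1] only. *)
Definition h2inv (R : realType) : R -> R := 'pinv_(fun=> 0) `[0, 2^-1] (@h2 R).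

Definition hweight (k : nat) (w : 'rV['F_2]_k) : nat :=
  #|[set j : 'I_k | w 0 j != 0]|%SET.

Definition dotF2 (k : nat) (w x : 'rV['F_2]_k) : 'F_2 :=
  \sum_(j < k) w 0 j * x 0 j.

(* The exponent is the representative of <w, x> in {0, 1}. *)
Definition fourier (R : realType) (k : nat) (f : 'rV['F_2]_k -> R)
    (w : 'rV['F_2]_k) : R :=
  \sum_(x : 'rV['F_2]_k) (-1) ^+ nat_of_ord (dotF2 w x) * f x.

Definition supp (k : nat) (Psi : 'rV['F_2]_k -> bool) : {set 'rV['F_2]_k} :=
  [set x | Psi x]%SET.

(* A maximum over a finite set of vectors, taken in the extended reals so that
   the neutral element -oo of the iterated maximum adds no spurious value. *)
Definition max_fourier_above (R : realType) (k : nat)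
    (Psi : 'rV['F_2]_k -> bool) (t : R) : \bar R :=
  \big[maxe/-oo%E]_(w : 'rV['F_2]_k | t <= (hweight w)%:R)
    (fourier (fun x => (Psi x)%:R) w)%:E.

(* Main.v *)
Require Import Defs.
From mathcomp Require Import all_boot all_order all_algebra.
From mathcomp Require Import all_classical all_reals all_analysis.
From mathcomp Require Import ring lra.
Set Implicit Arguments.
Unset Strict Implicit.
Unset Printing Implicit Defensive.
Import Order.TTheory GRing.Theory Num.Theory.
Import numFieldNormedType.Exports.
Local Open Scope classical_set_scope.
Local Open Scope ring_scope.

(** The numbers hat Psi(w) are the eigenvalues of the Cayley graph of F_2^k with
    connection set S = supp Psi: the character w is an eigenvector of the
    operator taking G to x |-> sum_(s in S) G (x + s).  Two facts about these
    eigenvalues are confronted.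

    First, there is a nonnegative function G that is nearly an eigenfunction
    for lam = n (2 sqrt (rho1 (1 - rho1)) - o(1)) and has small support.
    A subset Y of S has the sum of its elements as image in F_2^k, and
    adding s in S to that image amounts to toggling the membership of s in Y.
    So any weight phi (|Y|) on the subsets of S pushes forward to a function G
    on F_2^k on which the Cayley operator acts through the adjacency operator of
    an n-dimensional cube ([subset_sums_neighbours]).  Taking for phi a
    geometric sequence times a tent supported on the sizes just below rho1 n
    gives the near-eigenfunction ([geometric_tent_neighbours]).  Its support
    has at most exp (n h(rho1)) = exp (k h(rho1')) elements, where h is the
    entropy in nats ([small_support_test_function]).

    Second, a function on F_2^k whose support is that small has almost no
    Fourier mass on the frequencies of weight below rho2' k.  The quadratic form
    of the adjacency operator of the cube satisfies a logarithmic Sobolev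
    inequality, obtained by tensorizing a two-point inequality
    ([two_point_log_sobolev], [cube_log_sobolev]).  It bounds the Rayleigh
    quotient of any function supported on exp (k h(rho1')) points by
    2 k sqrt (rho1' (1 - rho1')), up to lower-order terms.  This only controls
    the mean frequency, but the iterates of the lazy walk A + k on G still have
    almost the same support size, since each step multiplies it by at most
    k + 1.  Applying the bound to the m-th iterate reweights the Fourier mass by
    the 2m-th power of the eigenvalue 2 (k - |w|), so that the mass of G at the
    frequencies where this eigenvalue exceeds the bound by a constant factor
    decays exponentially in m ([low_frequency_mass]).  The hypothesis on rho1'
    and rho2' says exactly that 2 sqrt (rho1' (1 - rho1')) < 1 - 2 rho2', which
    is this constant-factor gap at weight rho2' k.

    If M is the largest hat Psi(w) with |w| >= rho2' k, averaging hat Psi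
    against the Fourier mass of G gives lam <= M + 2 n (low-frequency fraction)
    ([frequency_cutoff_bound]).  All error terms are uniform in n and Psi, so
    for every e > 0 the loss is at most e n once k is large
    ([high_frequency_lower_bound]), and a sequence delta is extracted from these
    bounds ([vanishing_error]). *)

(** * Monotonicity on intervals *)

(** Discharges the non-vanishing conditions left by [field]. *)
Ltac field_side := repeat (apply/andP; split); apply/eqP; lra.

Lemma nonneg_derivative_le (R : realType) (f df : R -> R) (a b : R) :
  a <= b -> (forall x, a <= x <= b -> is_derive x 1 f (df x)) ->
  (forall x, a <= x <= b -> 0 <= df x) -> f a <= f b.
Proof.
move=> ab fdf df0.
have cf : {within `[a, b], continuous f}.
  apply: derivable_within_continuous => x; rewrite in_itv /= => /fdf H.
  exact: ex_derive.
have fdf' x : x \in `]a, b[ -> is_derive x 1 f (df x).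
  by rewrite in_itv /= => /andP[ax xb]; apply: fdf; rewrite (ltW ax) (ltW xb).
have [x] := MVT_segment ab fdf' cf.
rewrite in_itv /= => xab fE.
by rewrite -subr_ge0 fE mulr_ge0 ?subr_ge0// df0.
Qed.

Lemma nonpos_derivative_le (R : realType) (f df : R -> R) (a b : R) :
  a <= b -> (forall x, a <= x <= b -> is_derive x 1 f (df x)) ->
  (forall x, a <= x <= b -> df x <= 0) -> f b <= f a.
Proof.
move=> ab fdf df0; rewrite -lerN2.
apply: (@nonneg_derivative_le _ (\- f) (fun x => - df x)) => // x xab.
  by have := fdf x xab => ?; exact: is_derive_eq.
by rewrite oppr_ge0 df0.
Qed.

(** * The tangent inequality for the entropy of one bit *)

(** The difference of the two sides vanishes at 1 and has derivative
    (u - 1)^2 / (u (u + 1)^2).  With u = x^2 this is tanh y <= y for y = ln x. *)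
Lemma ln_ge_ratio (R : realType) (u : R) :
  1 <= u -> 2 * (u - 1) / (u + 1) <= ln u.
Proof.
move=> u1.
pose f (x : R) := ln x - (2 * (x - 1)) * (x + 1)^-1.
suff: f 1 <= f u by rewrite /f ln1 !subrr mulr0 mul0r; lra.
apply: (@nonneg_derivative_le _ _ (fun x => (x - 1) ^+ 2 / (x * (x + 1) ^+ 2))) => //.
  move=> x /andP[x1 _].
  have x0 : 0 < x by lra.
  have x10 : x + 1 != 0 by apply/eqP; lra.
  have := is_derive1_ln x0 => ?.
  rewrite /f; apply: is_derive_eq.
  rewrite /GRing.scale /=.
  by field; rewrite x10 /=; apply/eqP; lra.
move=> x /andP[x1 _]; apply: divr_ge0; first exact: sqr_ge0.
by apply: mulr_ge0; [lra|exact: sqr_ge0].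
Qed.

(** For s = exp y this is the monotonicity of sinh y / y on y > 0, up to a factor
    2; the sign of the derivative reduces to [ln_ge_ratio] at x^2. *)
Lemma sinh_ratio_le (R : realType) (s t : R) : 1 < s -> s <= t ->
  (s - s^-1) / ln s <= (t - t^-1) / ln t.
Proof.
move=> s1 st.
apply: (@nonneg_derivative_le _ (fun x : R => (x - x^-1) * (ln x)^-1)
  (fun x => ((1 + x^-1 ^+ 2) * ln x - (x - x^-1) / x) / (ln x) ^+ 2)) => //.
  move=> x /andP[x1 _].
  have x0 : 0 < x by lra.
  have xn0 : x != 0 by apply/eqP; lra.
  have lx0 : ln x != 0 by rewrite gt_eqF// ln_gt0//; lra.
  have := is_derive1_ln x0 => ?.
  have ? := @is_deriveV _ (fun x => x) x 1 1 xn0 _.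
  have ? := @is_deriveV _ (@ln R) x _ 1 lx0 _.
  apply: is_derive_eq.
  rewrite /GRing.scale /=.
  by field; rewrite xn0 lx0.
move=> x /andP[x1 _]; have x0 : 0 < x by lra.
apply: divr_ge0; last exact: sqr_ge0.
have x21 : 1 <= x ^+ 2 by apply: exprn_ege1; lra.
have := ln_ge_ratio x21; rewrite lnXn// mulr2n -mulrA.
set l := ln x; set q := (_ / _) => H.
have -> : (1 + x^-1 ^+ 2) * l - (x - x^-1) / x =
  (1 + x^-1 ^+ 2) * (l - q).
  by rewrite /q; field; field_side.
apply: mulr_ge0; last by lra.
by have := sqr_ge0 x^-1; lra.
Qed.

(** The entropy, in nats, of a bit taking its two values with odds t^2 : 1.  The
    parameter t is the ratio of the two values of a function on a two-point
    space, the probabilities being proportional to their squares. *)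
Definition entropy_odds (R : realType) (t : R) : R :=
  ln (1 + t ^+ 2) - (2 * t ^+ 2 * ln t) / (1 + t ^+ 2).

(** The slope, at odds T^2 : 1, of the curve describing 2 t / (1 + t^2) as a
    function of the entropy. *)
Definition tangent_slope (R : realType) (T : R) : R := (T - T^-1) / (2 * ln T).

Lemma tangent_slope_gt0 (R : realType) (T : R) : 1 < T -> 0 < tangent_slope T.
Proof.
move=> T1; apply: divr_gt0; last by rewrite mulr_gt0// ln_gt0.
by rewrite subr_gt0; apply: (lt_trans _ T1); rewrite invf_lt1//; lra.
Qed.

(** The quantity 2 t / (1 + t^2) is a concave function of the entropy, so that it
    lies below its tangent line at T.  Along the curve, the difference D has a
    derivative of the sign of (t - 1/t) / ln t - (T - 1/T) / ln T, negative before
    T and positive after it by [sinh_ratio_le]. *)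
Lemma tangent_odds (R : realType) (T t : R) : 1 < T -> 1 <= t ->
  2 * t / (1 + t ^+ 2) <= 2 * T / (1 + T ^+ 2)
     + tangent_slope T * (entropy_odds t - entropy_odds T).
Proof.
move=> T1 t1; pose c := tangent_slope T.
have T0 : 0 < T by lra.
pose D (x : R) := c * (ln (1 + x ^+ 2) - (2 * x ^+ 2 * ln x) * (1 + x ^+ 2)^-1)
                - 2 * x * (1 + x ^+ 2)^-1.
pose dD (x : R) := 2 * ((x ^+ 2 - 1) - 2 * c * x * ln x) / (1 + x ^+ 2) ^+ 2.
have dDP (x : R) : 1 <= x -> is_derive x 1 D (dD x).
  move=> x1; have x0 : 0 < x by lra.
  have x20 : 0 < 1 + x ^+ 2 by have := sqr_ge0 x; lra.
  have := is_derive1_ln x0 => ?.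
  have := is_derive1_ln x20 => H.
  have ? : is_derive x 1 (fun x : R => ln (1 + x ^+ 2)) ((2 * x) / (1 + x ^+ 2)).
    have ? : is_derive x 1 (fun x : R => 1 + x ^+ 2) (2 * x).
      by apply: is_derive_eq; rewrite /GRing.scale /=; ring.
    have := @is_derive1_comp _ (@ln R) (fun x : R => 1 + x ^+ 2) x _ _ H _.
    by rewrite mulrC; apply.
  have ? : 1 + x ^+ 2 != 0 by apply/eqP; lra.
  rewrite /D; apply: is_derive_eq; rewrite /dD /GRing.scale /=.
  by field; apply/andP; split; [|apply/eqP; lra].
have cE : 2 * c = (T - T^-1) / ln T.
  rewrite /c /tangent_slope; field; apply/andP; split; apply/eqP; last by lra.
  by have := ln_gt0 T1; lra.
have numE (x : R) : 1 < x -> x ^+ 2 - 1 - 2 * c * x * ln x =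
   x * ln x * ((x - x^-1) / ln x - 2 * c).
  move=> x1; field; apply/andP; split; apply/eqP; first by have := ln_gt0 x1; lra.
  by lra.
have key : D T <= D t.
  have [tT|Tt] := leP t T; last first.
    apply: (@nonneg_derivative_le _ D dD T t (ltW Tt)).
      by move=> x /andP[x1 _]; apply: dDP; lra.
    move=> x /andP[x1 _]; apply: divr_ge0; last exact: sqr_ge0.
    apply: mulr_ge0 => //; have x0 : 1 < x by lra.
    rewrite numE// cE; apply: mulr_ge0; last by rewrite subr_ge0 sinh_ratio_le.
    by rewrite mulr_ge0 ?ln_ge0//; lra.
  apply: (@nonpos_derivative_le _ D dD t T tT).
    by move=> x /andP[x1 _]; apply: dDP; lra.
  move=> x /andP[x1 xT]; rewrite /dD pmulr_lle0; last first.
    by rewrite invr_gt0 exprn_gt0//; have := sqr_ge0 x; lra.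
  (* At x = 1 the quotient by ln x is undefined and D has a critical point. *)
  rewrite pmulr_rle0//.
  have [->|x1'] := eqVneq x 1; first by rewrite ln1; lra.
  have x0 : 1 < x by rewrite lt_neqAle eq_sym x1'; lra.
  rewrite numE// cE pmulr_rle0; first by rewrite subr_le0 sinh_ratio_le.
  by rewrite mulr_gt0 ?ln_gt0//; lra.
move: key; rewrite /D /entropy_odds -/c; lra.
Qed.

(** * The two-point inequality *)

Definition xlnx (R : realType) (x : R) : R := x * ln x.

(** Measured in nats, whereas [h2] is in bits. *)
Definition entropy (R : realType) (q : R) : R := - xlnx q - xlnx (1 - q).

Lemma entropyE (R : realType) (q : R) : entropy q = h2 q * ln 2.
Proof.
have l2 : ln (2 : R) != 0 by rewrite gt_eqF// ln_gt0//; lra.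
by rewrite /entropy /xlnx /h2 /log2; field.
Qed.

Lemma entropy_oddsE (R : realType) (t : R) :
  0 < t -> entropy_odds t = entropy ((1 + t ^+ 2)^-1).
Proof.
move=> t0; have t20 : 0 < t ^+ 2 by rewrite exprn_gt0.
have u0 : 0 < 1 + t ^+ 2 by lra.
have uE : 1 - (1 + t ^+ 2)^-1 = t ^+ 2 / (1 + t ^+ 2).
  by field; field_side.
rewrite /entropy /xlnx uE ln_div ?posrE// lnV ?posrE// lnXn// mulr2n.
by rewrite /entropy_odds; field; field_side.
Qed.

(** A crude bound that forces the entropy to vanish at 0; it is used both to pass
    to the limit there and to keep rho1 away from 0. *)
Lemma entropy_le_sqrt (R : realType) (q : R) :
  0 < q < 1 -> entropy q <= 3 * Num.sqrt q.
Proof.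
move=> /andP[q0 q1]; set r := Num.sqrt q.
have r0 : 0 < r by rewrite sqrtr_gt0.
have qE : q = r ^+ 2 by rewrite sqr_sqrtr// ltW.
have r1 : r < 1 by rewrite -sqrtr1 ltr_sqrt.
have H1 : - xlnx q <= 2 * r.
  rewrite /xlnx qE lnXn// mulr2n.
  have : ln r^-1 < r^-1 by rewrite ln_sublinear// invr_gt0.
  rewrite lnV ?posrE// => H.
  have H' : r ^+ 2 * (- ln r) <= r ^+ 2 * r^-1 by rewrite ler_pM2l ?exprn_gt0// ltW.
  have E : r ^+ 2 * r^-1 = r by field; field_side.
  lra.
have H2 : - xlnx (1 - q) <= q.
  rewrite /xlnx; have i0 : 0 < (1 - q)^-1 by rewrite invr_gt0; lra.
  have := @le_ln1Dx R ((1 - q)^-1 - 1).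
  rewrite addrCA subrr addr0 lnV ?posrE; last by lra.
  move=> H; have {}H : - ln (1 - q) <= (1 - q)^-1 - 1 by apply: H; lra.
  have H' : (1 - q) * (- ln (1 - q)) <= (1 - q) * ((1 - q)^-1 - 1).
    by rewrite ler_pM2l; lra.
  have E : (1 - q) * ((1 - q)^-1 - 1) = q by field; field_side.
  lra.
have : q <= r by rewrite qE expr2 ler_piMr ?ltW.
by rewrite /entropy; lra.
Qed.

(** A logarithmic Sobolev inequality for the function with values x and y on two
    points: c multiplies the entropy of the distribution proportional to
    (x^2, y^2), times its total mass. *)
Definition two_point_ineq (R : realType) (b c : R) : Prop :=
  forall x y : R, 0 <= x -> 0 <= y -> 2 * x * y <= b * (x ^+ 2 + y ^+ 2)
    + c * (xlnx (x ^+ 2 + y ^+ 2) - xlnx (x ^+ 2) - xlnx (y ^+ 2)).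

(** With x = t y, dividing by x^2 + y^2 turns this into the tangent inequality at
    the T with 1 / (1 + T^2) = rho.  The degenerate case y = 0 says that b is
    nonnegative, which is the limit t --> +oo of the tangent inequality. *)
Lemma two_point_log_sobolev (R : realType) (rho : R) : 0 < rho < 1 / 2 ->
  exists2 c : R, 0 < c &
    two_point_ineq (2 * Num.sqrt (rho * (1 - rho)) - c * entropy rho) c.
Proof.
move=> /andP[r0 r2]; pose T := Num.sqrt ((1 - rho) / rho).
have T2 : T ^+ 2 = (1 - rho) / rho by rewrite sqr_sqrtr// divr_ge0//; lra.
have T1 : 1 < T.
  have q1 : 1 < (1 - rho) / rho by rewrite ltr_pdivlMr//; lra.
  by rewrite -sqrtr1 ltr_sqrt//; lra.
have T0 : 0 < T by lra.
have rE : (1 + T ^+ 2)^-1 = rho by rewrite T2; field; field_side.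
have aE : 2 * T / (1 + T ^+ 2) = 2 * Num.sqrt (rho * (1 - rho)).
  have -> : rho * (1 - rho) = (T * rho) ^+ 2.
    by rewrite exprMn T2; field; field_side.
  by rewrite sqrtr_sqr ger0_norm ?rE ?mulrA// mulr_ge0// ltW.
set a := 2 * Num.sqrt _ in aE *.
have eT : entropy_odds T = entropy rho by rewrite entropy_oddsE// rE.
pose c := tangent_slope T; have c0 : 0 < c by exact: tangent_slope_gt0.
exists c => //.
have tang t : 1 <= t -> 2 * t / (1 + t ^+ 2) <= a + c * (entropy_odds t - entropy rho).
  by move=> t1; rewrite -eT -aE; exact: tangent_odds.
(* If b were negative, equal to d, the tangent inequality would fail at a t
   for which 3 c / t, which bounds c times the entropy, is below - d. *)
have b0 : 0 <= a - c * entropy rho.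
  rewrite leNgt; apply/negP => d0; set d := a - _ in d0.
  pose t := 1 + 3 * c / (- d).
  have t1 : 1 <= t.
    by rewrite lerDl divr_ge0//; lra.
  have t0 : 0 < t by lra.
  have t2 : 0 < t ^+ 2 by rewrite exprn_gt0.
  have := tang _ t1; rewrite entropy_oddsE//.
  have q01 : 0 < (1 + t ^+ 2)^-1 < 1.
    by rewrite invr_gt0 invf_lt1; lra.
  have := entropy_le_sqrt q01; set q := (1 + t ^+ 2)^-1 => H.
  have qt : Num.sqrt q <= t^-1.
    have -> : t^-1 = Num.sqrt (t^-1 ^+ 2) by rewrite sqrtr_sqr ger0_norm// invr_ge0 ltW.
    rewrite ler_sqrt; last exact: sqr_ge0.
    by rewrite exprVn /q lef_pV2 ?posrE//; lra.
  have H1 : 0 <= 2 * t * q by rewrite !mulr_ge0 ?invr_ge0//; lra.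
  have H2 : c * entropy q <= c * (3 * t^-1) by rewrite ler_pM2l//; lra.
  have H3 : c * (3 * t^-1) < - d.
    rewrite mulrA ltr_pdivrMr//.
    have -> : - d * t = - d + 3 * c by rewrite /t; field; field_side.
    by lra.
  move=> H4; move: d0; rewrite /d; rewrite /d in H3; lra.
have main x y : 0 < y -> y <= x ->
    2 * x * y <= (a - c * entropy rho) * (x ^+ 2 + y ^+ 2)
      + c * (xlnx (x ^+ 2 + y ^+ 2) - xlnx (x ^+ 2) - xlnx (y ^+ 2)).
  move=> y0 yx; have x0 : 0 < x by lra.
  pose t := x / y; have t1 : 1 <= t by rewrite ler_pdivlMr//; lra.
  have t0 : 0 < t by lra.
  have xE : x = t * y by rewrite /t divfK// gt_eqF.
  clearbody t.
  have y2 : 0 < y ^+ 2 by rewrite exprn_gt0.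
  have t2 : 0 < t ^+ 2 by rewrite exprn_gt0.
  have sE : x ^+ 2 + y ^+ 2 = (1 + t ^+ 2) * y ^+ 2 by rewrite xE; ring.
  have s0 : 0 <= (1 + t ^+ 2) * y ^+ 2 by rewrite mulr_ge0//; lra.
  have := ler_wpM2r s0 (tang _ t1).
  have -> : 2 * t / (1 + t ^+ 2) * ((1 + t ^+ 2) * y ^+ 2) = 2 * x * y.
    by rewrite xE; field; field_side.
  move=> /le_trans; apply; rewrite sE.
  have -> : xlnx ((1 + t ^+ 2) * y ^+ 2) - xlnx (x ^+ 2) - xlnx (y ^+ 2)
            = entropy_odds t * ((1 + t ^+ 2) * y ^+ 2).
    rewrite /xlnx xE exprMn !lnM ?posrE//; last by lra.
    by rewrite /entropy_odds; field; field_side.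
  by rewrite le_eqVlt; apply/orP; left; apply/eqP; ring.
have xlnx0 : xlnx 0 = 0 :> R by rewrite /xlnx mul0r.
move=> x y; rewrite le_eqVlt => /predU1P[<- _|x0].
  by rewrite expr0n /= !add0r mulr0 mul0r xlnx0 subr0 subrr mulr0 addr0 mulr_ge0 ?sqr_ge0.
rewrite le_eqVlt => /predU1P[<-|y0].
  by rewrite expr0n /= !addr0 mulr0 xlnx0 subr0 subrr mulr0 addr0 mulr_ge0 ?sqr_ge0.
have [yx|xy] := leP y x; first exact: main.
by have := main y x x0 (ltW xy); rewrite mulrAC [y ^+ 2 + _]addrC addrAC.
Qed.

(** * The logarithmic Sobolev inequality on the cube *)

Lemma cauchy_schwarz_sum (R : realType) (T : finType) (f g : T -> R) :
  \sum_x f x * g x <= Num.sqrt (\sum_x f x ^+ 2) * Num.sqrt (\sum_x g x ^+ 2).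
Proof.
set X : R := \sum_x f x ^+ 2; set Y : R := \sum_x g x ^+ 2.
set p : R := \sum_x f x * g x.
have X0 : 0 <= X by apply: sumr_ge0 => x _; exact: sqr_ge0.
have Y0 : 0 <= Y by apply: sumr_ge0 => x _; exact: sqr_ge0.
have E : \sum_x (Y * f x - p * g x) ^+ 2 = Y * (X * Y - p ^+ 2).
  rewrite (eq_bigr (fun x => Y ^+ 2 * f x ^+ 2 - 2 * Y * p * (f x * g x)
    + p ^+ 2 * g x ^+ 2)) => [|x _]; last by ring.
  rewrite big_split /= sumrB -!mulr_sumr -/X -/Y -/p. ring.
have : 0 <= Y * (X * Y - p ^+ 2).
  by rewrite -E; apply: sumr_ge0 => x _; exact: sqr_ge0.
rewrite -sqrtrM//; move: Y0; rewrite le_eqVlt => /predU1P[Y0 _|Y0].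
  have g0 x : g x = 0.
    have /psumr_eq0P := esym Y0; move/(_ (fun x _ => sqr_ge0 (g x))) => /(_ x isT).
    by move/eqP; rewrite sqrf_eq0 => /eqP.
  by rewrite /p big1 ?sqrtr_ge0// => x _; rewrite g0 mulr0.
rewrite pmulr_rge0// subr_ge0 => H.
by apply: le_trans (ler_norm p) _; rewrite -sqrtr_sqr ler_wsqrtr.
Qed.

Definition cons_bit (k : nat) (a : 'F_2) (y : 'rV['F_2]_k) : 'rV['F_2]_k.+1 :=
  @row_mx _ 1 1 k (const_mx a) y.

Lemma cons_bit_bij (k : nat) :
  bijective (fun p : 'F_2 * 'rV['F_2]_k => cons_bit p.1 p.2).
Proof.
exists (fun x : 'rV['F_2]_(1 + k) => (lsubmx x 0 0, rsubmx x)) => [[a y]|x] /=.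
  by rewrite row_mxKl row_mxKr mxE.
rewrite /cons_bit -[RHS](@hsubmxK _ 1 1 k); congr row_mx.
by apply/rowP => i; rewrite ord1 !mxE.
Qed.

Lemma big_cons_bit (R : realType) (k : nat) (F : 'rV['F_2]_k.+1 -> R) :
  \sum_x F x = \sum_y F (cons_bit 0 y) + \sum_y F (cons_bit 1 y).
Proof.
rewrite (reindex _ (onW_bij _ (cons_bit_bij k))) /=.
rewrite -(pair_bigA _ (fun a y => F (cons_bit a y))) /=.
rewrite !big_ord_recl big_ord0 addr0.
have -> : ord0 = 0 :> 'F_2 by apply/val_inj.
by have -> : lift 0 ord0 = 1 :> 'F_2 by apply/val_inj.
Qed.

Lemma cons_bitE0 (k : nat) a (y : 'rV['F_2]_k) : cons_bit a y 0 0 = a.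
Proof.
by rewrite mxE; case: splitP => // l _; rewrite mxE.
Qed.

Lemma cons_bitES (k : nat) a (y : 'rV['F_2]_k) (j : 'I_k) :
  cons_bit a y 0 (lift ord0 j) = y 0 j.
Proof.
rewrite mxE; case: splitP => [[[|//] l0] //|l /= E].
by congr (y 0 _); apply/val_inj => /=; case: E.
Qed.

Lemma cons_bit_flip0 (k : nat) a (y : 'rV['F_2]_k) :
  cons_bit a y + delta_mx 0 0 = cons_bit (a + 1) y.
Proof.
apply/rowP => i; rewrite [LHS]mxE; case: (unliftP ord0 i) => [j|] ->.
  by rewrite !cons_bitES mxE addr0.
by rewrite !cons_bitE0 mxE.
Qed.

Lemma cons_bit_flipS (k : nat) a (y : 'rV['F_2]_k) (j : 'I_k) :
  cons_bit a y + delta_mx 0 (lift ord0 j) = cons_bit a (y + delta_mx 0 j).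
Proof.
apply/rowP => i; rewrite [LHS]mxE; case: (unliftP ord0 i) => [l|] ->.
  by rewrite !cons_bitES !mxE (inj_eq lift_inj).
by rewrite !cons_bitE0 mxE (negbTE (neq_lift _ _)) andbF addr0.
Qed.

(** Tensorization.  Splitting off the first bit, the edges inside the two
    half-cubes are handled by induction, and the edges between them contribute at
    most 2 ||f0|| ||f1|| by Cauchy-Schwarz, to which the two-point inequality
    applies.  The entropy terms then add up exactly, by the chain rule. *)
Lemma cube_log_sobolev (R : realType) (b c : R) (k : nat) (f : 'rV['F_2]_k -> R) :
  0 <= c ->
  two_point_ineq b c ->
  \sum_x \sum_(i < k) f x * f (x + delta_mx 0 i) <=
    k%:R * b * \sum_x f x ^+ 2
    + c * (xlnx (\sum_x f x ^+ 2) - \sum_x xlnx (f x ^+ 2)).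
Proof.
move=> c0 two; elim: k f => [|k IH] f.
  have E (g : 'rV['F_2]_0 -> R) : \sum_x g x = g 0.
    by apply: (big_pred1 0) => x; rewrite [x]thinmx0; apply/esym/eqP.
  by rewrite !E big_ord0 mul0r mul0r subrr mulr0 addr0.
pose f0 y := f (cons_bit 0 y); pose f1 y := f (cons_bit 1 y).
rewrite !big_cons_bit -/f0 -/f1.
under eq_bigr do rewrite big_ord_recl cons_bit_flip0 add0r.
under [X in _ + X <= _]eq_bigr do rewrite big_ord_recl cons_bit_flip0.
have -> : 1 + 1 = 0 :> 'F_2 by apply/val_inj.
rewrite !big_split /=.
under [X in _ + X + _ <= _]eq_bigr do under eq_bigr do rewrite cons_bit_flipS.
under [X in _ + (_ + X) <= _]eq_bigr do under eq_bigr do rewrite cons_bit_flipS.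
have := IH f0; have := IH f1.
have := cauchy_schwarz_sum f0 f1.
rewrite /f0 /f1.
set X : R := \sum_y f (cons_bit 0 y) ^+ 2; set Y : R := \sum_y f (cons_bit 1 y) ^+ 2.
have X0 : 0 <= X by apply: sumr_ge0 => x _; exact: sqr_ge0.
have Y0 : 0 <= Y by apply: sumr_ge0 => x _; exact: sqr_ge0.
have := two _ _ (sqrtr_ge0 X) (sqrtr_ge0 Y); rewrite !sqr_sqrtr//.
set q := Num.sqrt X * Num.sqrt Y.
have -> : 2 * Num.sqrt X * Num.sqrt Y = 2 * q by rewrite /q mulrA.
have -> : \sum_y f (cons_bit 1 y) * f (cons_bit 0 y) =
  \sum_y f (cons_bit 0 y) * f (cons_bit 1 y) by apply: eq_bigr => y _; rewrite mulrC.
rewrite -natr1 => H1 H2 H3 H4.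
lra.
Qed.

(** The uniform distribution has the largest entropy among those supported on E;
    p is not normalized. *)
Lemma entropy_le_ln_card (R : realType) (T : finType) (E : {set T}) (p : T -> R) :
  (forall x, 0 <= p x) -> (forall x, x \notin E -> p x = 0) ->
  xlnx (\sum_x p x) - \sum_x xlnx (p x) <= (\sum_x p x) * ln #|E|%:R.
Proof.
move=> p0 pE; set S : R := \sum_x p x.
have S0 : 0 <= S by apply: sumr_ge0.
have SE : S = \sum_(x in E) p x.
  rewrite /S (bigID (mem E)) /= [X in _ + X]big1 ?addr0// => x; exact: pE.
have [Sz|Sn] := eqVneq S 0.
  have pz x : p x = 0 by apply: (psumr_eq0P (fun x _ => p0 x) Sz).
  by rewrite Sz /xlnx !mul0r big1 ?subrr// => x _; rewrite pz mul0r.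
have Sp : 0 < S by rewrite lt_neqAle eq_sym Sn.
have E0 : (0 < #|E|)%N.
  rewrite lt0n; apply/eqP => /eqP; rewrite cards_eq0 => /eqP E0.
  by move: Sn; rewrite SE E0 big_set0 eqxx.
have N0 : 0 < #|E|%:R :> R by rewrite ltr0n.
have H x : x \in E -> p x * (ln S - ln (p x) - ln #|E|%:R) <= S / #|E|%:R - p x.
  move=> xE; have := p0 x; rewrite le_eqVlt => /predU1P[<-|px].
    by rewrite mul0r subr0 divr_ge0// ltW.
  have q0 : 0 < S / (p x * #|E|%:R) by rewrite divr_gt0// mulr_gt0.
  have := @le_ln1Dx R (S / (p x * #|E|%:R) - 1).
  rewrite addrCA subrr addr0 ln_div ?posrE ?mulr_gt0// lnM ?posrE//.
  move=> /(_ _)/wrap[]; first by lra.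
  move=> H; have := ler_wpM2l (ltW px) H.
  by rewrite opprD addrA => /le_trans; apply; rewrite le_eqVlt; apply/orP; left;
    apply/eqP; field; field_side.
have : \sum_(x in E) p x * (ln S - ln (p x) - ln #|E|%:R) <= 0.
  apply: (le_trans (ler_sum _ H)).
  by rewrite sumrB -SE sumr_const -[X in X - _]mulr_natr divfK ?subrr// gt_eqF.
have -> : \sum_(x in E) p x * (ln S - ln (p x) - ln #|E|%:R) =
   xlnx S - \sum_x xlnx (p x) - S * ln #|E|%:R.
  have -> : \sum_x xlnx (p x) = \sum_(x in E) xlnx (p x).
    rewrite (bigID (mem E)) /= [X in _ + X]big1 ?addr0// => x xE.
    by rewrite /xlnx pE// mul0r.
  rewrite (eq_bigr (fun x => p x * ln S - xlnx (p x) - p x * ln #|E|%:R)).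
    by rewrite !sumrB -!mulr_suml -SE.
  by move=> x _; rewrite /xlnx; ring.
by lra.
Qed.

(** * Characters and the lazy walk *)

Definition chi (R : realType) (k : nat) (w x : 'rV['F_2]_k) : R :=
  (-1) ^+ nat_of_ord (dotF2 w x).

Lemma sign_F2D (R : realType) (a b : 'F_2) :
  (-1) ^+ nat_of_ord (a + b) = (-1) ^+ nat_of_ord a * (-1) ^+ nat_of_ord b :> R.
Proof.
case: a => [[|[|//]] ?]; case: b => [[|[|//]] ?];
  by rewrite /= ?(expr0, expr1, mul1r, mulr1, mulrNN).
Qed.

Lemma addF2_self (k : nat) (x : 'rV['F_2]_k) : x + x = 0.
Proof.
apply/rowP => i; rewrite !mxE; case: (x 0 i) => [[|[|//]] ?]; exact/val_inj.
Qed.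

Lemma addF2K (k : nat) (s : 'rV['F_2]_k) : involutive (fun x => x + s).
Proof. by move=> x; rewrite -addrA addF2_self addr0. Qed.

Lemma chiC (R : realType) (k : nat) (w x : 'rV['F_2]_k) : chi R w x = chi R x w.
Proof. by congr (_ ^+ nat_of_ord _); apply: eq_bigr => i _; rewrite mulrC. Qed.

Lemma chiDr (R : realType) (k : nat) (w x y : 'rV['F_2]_k) :
  chi R w (x + y) = chi R w x * chi R w y.
Proof.
rewrite /chi -sign_F2D; congr (_ ^+ nat_of_ord _); rewrite -big_split.
by apply: eq_bigr => i _; rewrite mxE mulrDr.
Qed.

Lemma chi0 (R : realType) (k : nat) (w : 'rV['F_2]_k) : chi R w 0 = 1.
Proof. by rewrite /chi /dotF2 big1// => i _; rewrite mxE mulr0. Qed.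

Lemma chi_delta (R : realType) (k : nat) (w : 'rV['F_2]_k) (i : 'I_k) :
  chi R w (delta_mx 0 i) = if w 0 i == 0 then 1 else -1.
Proof.
rewrite /chi (_ : dotF2 w _ = w 0 i).
  by case: (w 0 i) => [[|[|//]] ?].
rewrite /dotF2 (bigD1 i)//= mxE !eqxx mulr1 big1 ?addr0// => j ji.
by rewrite mxE (negbTE ji) mulr0.
Qed.

Lemma sum_chi (R : realType) (k : nat) (x : 'rV['F_2]_k) :
  \sum_w chi R w x = if x == 0 then 2 ^+ k else 0.
Proof.
case: eqP => [->|/eqP x0].
  under eq_bigr do rewrite chi0.
  by rewrite sumr_const card_mx card_Fp// mul1n -natrX.
have [i xi] : exists i, x 0 i != 0 by apply/rV0Pn.
have E : \sum_w chi R w x = - \sum_w chi R w x.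
  rewrite {1}(reindex_inj (inv_inj (addF2K (delta_mx 0 i)))) -sumrN.
  apply: eq_bigr => w _; rewrite chiC chiDr chi_delta (negbTE xi) mulrN1 chiC.
  by [].
by move: E; set S := \sum_w _ => E; lra.
Qed.

Lemma fourierE (R : realType) (k : nat) (f : 'rV['F_2]_k -> R) w :
  fourier f w = \sum_x chi R w x * f x.
Proof. by []. Qed.

Lemma fourier_shift (R : realType) (k : nat) (f : 'rV['F_2]_k -> R) s w :
  fourier (fun x => f (x + s)) w = chi R w s * fourier f w.
Proof.
rewrite !fourierE mulr_sumr (reindex_inj (inv_inj (addF2K s))).
by apply: eq_bigr => x _; rewrite chiDr addF2K; ring.
Qed.

Lemma parseval (R : realType) (k : nat) (f g : 'rV['F_2]_k -> R) :
  \sum_w fourier f w * fourier g w = 2 ^+ k * \sum_x f x * g x.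
Proof.
transitivity (\sum_x \sum_y f x * g y * \sum_w chi R w (x + y)).
  rewrite (eq_bigr (fun w => \sum_x \sum_y f x * g y * chi R w (x + y))).
    rewrite exchange_big; apply: eq_bigr => x _.
    by rewrite exchange_big; apply: eq_bigr => y _; rewrite mulr_sumr.
  move=> w _; rewrite !fourierE mulr_suml; apply: eq_bigr => x _.
  by rewrite mulr_sumr; apply: eq_bigr => y _; rewrite chiDr; ring.
rewrite mulr_sumr; apply: eq_bigr => x _.
rewrite (bigD1 x)//= [X in _ + X]big1 => [|y yx].
  by rewrite sum_chi addF2_self eqxx addr0 mulrC.
rewrite sum_chi; case: eqP => [xy0|]; last by rewrite mulr0.
by move: yx; rewrite -[y](addF2K x) [y + x]addrC xy0 add0r eqxx.
Qed.

Lemma sum_chi_delta (R : realType) (k : nat) (w : 'rV['F_2]_k) :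
  \sum_(i < k) (1 + chi R w (delta_mx 0 i)) = 2 * (k%:R - (hweight w)%:R).
Proof.
have -> : k%:R - (hweight w)%:R = \sum_(i < k) (w 0 i == 0)%:R :> R.
  have -> : (hweight w)%:R = \sum_(i < k) (w 0 i != 0)%:R :> R.
    rewrite /hweight -sum1_card natr_sum big_mkcond /=.
    by apply: eq_bigr => i _; rewrite inE; case: (w 0 i != 0).
  have -> : k%:R = \sum_(i < k) 1 :> R by rewrite sumr_const card_ord.
  rewrite -sumrB; apply: eq_bigr => i _; case: (w 0 i == 0) => /=; ring.
rewrite mulr_sumr; apply: eq_bigr => i _; rewrite chi_delta.
by case: (w 0 i == 0) => /=; ring.
Qed.

(** The adjacency operator of the cube plus k times the identity.  The shift
    makes all eigenvalues nonnegative, so that their powers are monotone. *)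
Definition lazy_walk (R : realType) (k : nat) (f : 'rV['F_2]_k -> R) :
  'rV['F_2]_k -> R := fun x => \sum_(i < k) (f x + f (x + delta_mx 0 i)).

Lemma fourier_lazy_walk (R : realType) (k : nat) (f : 'rV['F_2]_k -> R) w :
  fourier (lazy_walk f) w = 2 * (k%:R - (hweight w)%:R) * fourier f w.
Proof.
rewrite -sum_chi_delta mulr_suml fourierE.
under eq_bigr do rewrite mulr_sumr.
rewrite exchange_big; apply: eq_bigr => i _.
rewrite mulrDl mul1r -fourier_shift !fourierE -big_split /=.
by apply: eq_bigr => x _; rewrite mulrDr.
Qed.

Lemma fourier_iter_lazy_walk (R : realType) (k m : nat) (f : 'rV['F_2]_k -> R) w :
  fourier (iter m (@lazy_walk R k) f) w
  = (2 * (k%:R - (hweight w)%:R)) ^+ m * fourier f w.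
Proof.
elim: m => [|m IH]; first by rewrite mul1r.
by rewrite iterS fourier_lazy_walk IH mulrA exprS.
Qed.

Lemma iter_lazy_walk_support (R : realType) (k m : nat) (f : 'rV['F_2]_k -> R)
    (E : {set 'rV['F_2]_k}) : (forall x, x \notin E -> f x = 0) ->
  exists2 E' : {set 'rV['F_2]_k}, (#|E'| <= #|E| * k.+1 ^ m)%N &
    forall x, x \notin E' -> iter m (@lazy_walk R k) f x = 0.
Proof.
move=> fE; elim: m => [|m [E' cE' IH]]; first by exists E => //; rewrite muln1.
pose step (o : option 'I_k) : 'rV['F_2]_k :=
  if o is Some i then delta_mx 0 i else 0.
exists [set p.1 + step p.2 | p in finset.setX E' [set: option 'I_k]]%SET.
  apply: leq_trans (leq_imset_card _ _) _.
  rewrite cardsX cardsT card_option card_ord expnS mulnCA mulnC.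
  by rewrite leq_mul2l cE' orbT.
move=> x xE; rewrite iterS /lazy_walk big1// => i _.
rewrite !IH ?addr0//; apply: contra xE => xE.
  by apply/imsetP; exists (x + delta_mx 0 i, Some i); rewrite ?inE ?andbT//= addF2K.
by apply/imsetP; exists (x, None); rewrite ?inE ?andbT//= addr0.
Qed.

(** A Faber-Krahn inequality: a function of small support has a small Rayleigh
    quotient, because its square has a small entropy. *)
Lemma lazy_walk_rayleigh (R : realType) (b c : R) (k : nat)
    (f : 'rV['F_2]_k -> R) (E : {set 'rV['F_2]_k}) :
  0 <= c ->
  two_point_ineq b c ->
  (forall x, x \notin E -> f x = 0) ->
  \sum_x f x * lazy_walk f x
    <= (k%:R * (1 + b) + c * ln #|E|%:R) * \sum_x f x ^+ 2.
Proof.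
move=> c0 two fE.
have H1 := cube_log_sobolev f c0 two.
have H2 : xlnx (\sum_x f x ^+ 2) - \sum_x xlnx (f x ^+ 2)
   <= (\sum_x f x ^+ 2) * ln #|E|%:R.
  apply: entropy_le_ln_card => x; first exact: sqr_ge0.
  by move=> /fE ->; rewrite expr0n.
have -> : \sum_x f x * lazy_walk f x =
  k%:R * \sum_x f x ^+ 2 + \sum_x \sum_(i < k) f x * f (x + delta_mx 0 i).
  rewrite mulr_sumr -big_split; apply: eq_bigr => x _ /=.
  rewrite /lazy_walk big_split /= sumr_const card_ord mulrDr mulr_sumr.
  by rewrite -mulr_natl; ring.
have := ler_wpM2l c0 H2.
set S := \sum_x f x ^+ 2 in H1 *; lra.
Qed.

(** * Functions of small support have little low-frequency mass *)

Lemma ler_ln_natr (R : realType) (m n : nat) : (m <= n)%N -> ln m%:R <= ln n%:R :> R.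
Proof.
case: m => [|m] mn; last by rewrite ler_ln ?posrE ?ltr0n ?ler_nat//; apply: leq_trans mn.
by case: n mn => [//|n] _; rewrite (ln0 (lexx 0)) ln_ge0// ler1n.
Qed.

(** The m-th iterate h of the lazy walk on f has Fourier transform z^m hat f, where
    z w = 2 (k - |w|), and a support of at most |E| (k + 1)^m points, so that its
    Rayleigh quotient is at most Lam.  In terms of f, the sum of
    z^(2m) (z - Lam) (hat f)^2 is nonpositive: the contribution of the frequencies
    with z >= z0 is balanced by those with z < Lam, where z^(2m) (Lam - z) is at
    most Lam^(2m+1). *)
Lemma low_frequency_mass (R : realType) (b c Lam z0 : R) (k m : nat)
    (f : 'rV['F_2]_k -> R) (E : {set 'rV['F_2]_k}) :
  0 <= c ->
  two_point_ineq b c ->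
  (forall x, x \notin E -> f x = 0) ->
  0 <= Lam < z0 ->
  k%:R * (1 + b) + c * ln (#|E| * k.+1 ^ m)%:R <= Lam ->
  z0 ^+ (2 * m) * (z0 - Lam) *
      \sum_(w | z0 <= 2 * (k%:R - (hweight w)%:R)) fourier f w ^+ 2
    <= Lam ^+ (2 * m).+1 * \sum_w fourier f w ^+ 2.
Proof.
move=> c0 two fE /andP[L0 Lz0] HL; pose z (w : 'rV['F_2]_k) : R := 2 * (k%:R - (hweight w)%:R).
have z_ge0 w : 0 <= z w.
  rewrite mulr_ge0// subr_ge0 ler_nat -[leqRHS]card_ord; exact: max_card.
have [E' cE' fmE] := iter_lazy_walk_support m fE.
pose h := iter m (@lazy_walk R k) f.
have zh w : fourier h w = z w ^+ m * fourier f w by exact: fourier_iter_lazy_walk.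
have mean : \sum_w z w ^+ (2 * m) * (z w - Lam) * fourier f w ^+ 2 <= 0.
  have := @lazy_walk_rayleigh _ b c k h E' c0 two fmE.
  have p2 : 0 <= (2 : R) ^+ k by rewrite exprn_ge0.
  have HL' : k%:R * (1 + b) + c * ln #|E'|%:R <= Lam.
    by apply: le_trans HL; rewrite lerD2l ler_wpM2l// ler_ln_natr.
  have S0 : 0 <= \sum_x h x ^+ 2 by apply: sumr_ge0 => x _; exact: sqr_ge0.
  move=> /le_trans /(_ (ler_wpM2r S0 HL')) /(ler_wpM2l p2).
  rewrite mulrCA -parseval.
  have -> : 2 ^+ k * \sum_x h x ^+ 2 = \sum_w fourier h w * fourier h w.
    by rewrite parseval.
  rewrite mulr_sumr -subr_le0 -sumrB => H; apply: le_trans H.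
  rewrite le_eqVlt; apply/orP; left; apply/eqP; apply: eq_bigr => w _.
  by rewrite fourier_lazy_walk zh mulnC exprM -/(z w); ring.
have pt (w : 'rV['F_2]_k) : z0 ^+ (2 * m) * (z0 - Lam) * (z0 <= z w)%R%:R
    <= z w ^+ (2 * m) * (z w - Lam) + Lam ^+ (2 * m).+1.
  have La : 0 <= Lam ^+ (2 * m).+1 by rewrite exprn_ge0.
  case: (leP z0 (z w)) => [zz|_] /=.
    have : z0 ^+ (2 * m) * (z0 - Lam) <= z w ^+ (2 * m) * (z w - Lam).
      apply: ler_pM; rewrite ?exprn_ge0 ?subr_ge0 ?lerB ?lerXn2r ?nnegrE//; lra.
    by lra.
  rewrite mulr0; have [zL|zL] := leP (z w) Lam.
    have : z w ^+ (2 * m) * (Lam - z w) <= Lam ^+ (2 * m) * Lam.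
      by apply: ler_pM; rewrite ?exprn_ge0 ?subr_ge0 ?lerXn2r ?nnegrE//; have := z_ge0 w; lra.
    by rewrite -exprSr; lra.
  have : 0 <= z w ^+ (2 * m) * (z w - Lam) by rewrite mulr_ge0 ?exprn_ge0 ?subr_ge0// ltW.
  by lra.
have : \sum_w z0 ^+ (2 * m) * (z0 - Lam) * (z0 <= z w)%R%:R * fourier f w ^+ 2
   <= \sum_w (z w ^+ (2 * m) * (z w - Lam) + Lam ^+ (2 * m).+1) * fourier f w ^+ 2.
  by apply: ler_sum => w _; rewrite ler_wpM2r ?sqr_ge0.
rewrite [X in _ <= X -> _](eq_bigr (fun w => z w ^+ (2 * m) * (z w - Lam) * fourier f w ^+ 2
   + Lam ^+ (2 * m).+1 * fourier f w ^+ 2)); last by move=> w _; rewrite mulrDl.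
rewrite big_split /= -mulr_sumr => H.
have -> : z0 ^+ (2 * m) * (z0 - Lam) * \sum_(w | z0 <= 2 * (k%:R - (hweight w)%:R)) fourier f w ^+ 2
  = \sum_w z0 ^+ (2 * m) * (z0 - Lam) * (z0 <= z w)%R%:R * fourier f w ^+ 2.
  rewrite mulr_sumr big_mkcond; apply: eq_bigr => w _; rewrite -/(z w).
  by case: (z0 <= z w); rewrite ?mulr1 ?mulr0 ?mul0r.
by apply: le_trans H _; rewrite gerDr.
Qed.

(** * Subset sums of the connection set *)

Definition toggle (T : finType) (s : T) (Y : {set T}) : {set T} :=
  if s \in Y then (Y :\ s)%SET else (s |: Y)%SET.

Lemma toggleK (T : finType) (s : T) : involutive (toggle s).
Proof.
move=> Y; rewrite /toggle; case: (boolP (s \in Y)) => sY.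
  by rewrite finset.setD11 finset.setD1K.
by rewrite finset.setU11 finset.setU1K.
Qed.

Lemma toggle_sub (T : finType) (s : T) (Y S : {set T}) :
  s \in S -> (toggle s Y \subset S) = (Y \subset S).
Proof.
move=> sS; rewrite /toggle; case: ifP => sY; last by rewrite finset.subUset finset.sub1set sS.
by rewrite finset.subDset (finset.setUidPr _)// finset.sub1set.
Qed.

(** The push-forward of the radial function Y |-> phi #|Y| on the subsets of S
    under the map sending a subset to the sum of its elements. *)
Definition subset_sums (R : realType) (k : nat) (S : {set 'rV['F_2]_k})
    (phi : nat -> R) (x : 'rV['F_2]_k) : R :=
  \sum_(Y : {set 'rV['F_2]_k} | (Y \subset S) && (\sum_(y in Y) y == x)) phi #|Y|.

Lemma sum_toggle (k : nat) (s : 'rV['F_2]_k) (Y : {set 'rV['F_2]_k}) :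
  \sum_(y in toggle s Y) y = \sum_(y in Y) y + s.
Proof.
rewrite /toggle; case: ifP => sY; last by rewrite big_setU1 ?sY//= addrC.
by rewrite [in RHS](big_setD1 s)//= addrAC addF2_self add0r.
Qed.

(** Translating by s in S corresponds to toggling s, an involution on the subsets
    of S.  Toggling all elements of S in turn yields #|Y| subsets with one element
    less and #|S| - #|Y| subsets with one element more. *)
Lemma subset_sums_neighbours (R : realType) (k : nat) (S : {set 'rV['F_2]_k})
    (phi : nat -> R) x :
  \sum_(s in S) subset_sums S phi (x + s)
  = subset_sums S (fun j => j%:R * phi j.-1 + (#|S|%:R - j%:R) * phi j.+1) x.
Proof.
rewrite (eq_bigr (fun s => \sum_(Y : {set 'rV['F_2]_k} | (Y \subset S) &&
    (\sum_(y in Y) y == x)) phi #|toggle s Y|)) => [|s sS]; last first.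
  rewrite /subset_sums (reindex_inj (inv_inj (@toggleK _ s))).
  apply: eq_bigl => Y; rewrite toggle_sub// sum_toggle.
  by rewrite (inj_eq (addIr s)).
rewrite exchange_big; apply: eq_bigr => Y /andP[YS _].
rewrite (bigID (mem Y)) /=; congr (_ + _).
  rewrite (eq_bigl (fun s => s \in Y)) => [|s]; last first.
    by rewrite /= andbC; case: (boolP (s \in Y)) => //= /(fintype.subsetP YS) ->.
  rewrite (eq_bigr (fun=> phi #|Y|.-1)) => [|s sY]; first by rewrite sumr_const mulr_natl.
  by rewrite /toggle sY [in RHS](cardsD1 s) sY.
rewrite (eq_bigl (fun s => s \in S :\: Y)%SET) => [|s]; last by rewrite /= inE andbC.
rewrite (eq_bigr (fun=> phi #|Y|.+1)) => [|s]; last first.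
  by rewrite /= inE => /andP[sY _]; rewrite /toggle (negbTE sY) cardsU1 sY.
rewrite sumr_const cardsD (finset.setIidPr YS) -[LHS]mulr_natl natrB//.
exact: subset_leq_card.
Qed.

Lemma subset_sums_neighbours_ge (R : realType) (k : nat) (S : {set 'rV['F_2]_k})
    (phi : nat -> R) (lam : R) x :
  (forall j, (j <= #|S|)%N ->
    lam * phi j <= j%:R * phi j.-1 + (#|S|%:R - j%:R) * phi j.+1) ->
  lam * subset_sums S phi x <= \sum_(s in S) subset_sums S phi (x + s).
Proof.
move=> H; rewrite subset_sums_neighbours mulr_sumr; apply: ler_sum => Y /andP[YS _].
by apply: H; exact: subset_leq_card.
Qed.

Lemma sum_fourier_set (R : realType) (k : nat) (Psi : 'rV['F_2]_k -> bool)
    (G : 'rV['F_2]_k -> R) :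
  \sum_w fourier (fun x => (Psi x)%:R) w * fourier G w ^+ 2
  = 2 ^+ k * \sum_x G x * \sum_(s in supp Psi) G (x + s).
Proof.
have E w : fourier (fun x => (Psi x)%:R) w = \sum_(s in supp Psi) chi R w s.
  rewrite fourierE [RHS]big_mkcond; apply: eq_bigr => s _.
  by rewrite inE; case: (Psi s); rewrite ?mulr1 ?mulr0.
rewrite (eq_bigr (fun w => \sum_(s in supp Psi)
    fourier G w * fourier (fun x => G (x + s)) w)) => [|w _]; last first.
  by rewrite E mulr_suml; apply: eq_bigr => s _; rewrite fourier_shift; ring.
rewrite exchange_big /= (eq_bigr _ (fun s _ => parseval _ _)) -mulr_sumr exchange_big.
by congr (_ * _); apply: eq_bigr => x _; rewrite mulr_sumr.
Qed.

Lemma fourier_set_le (R : realType) (k : nat) (Psi : 'rV['F_2]_k -> bool) w :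
  `|fourier (fun x => (Psi x)%:R : R) w| <= #|supp Psi|%:R.
Proof.
rewrite fourierE; apply: le_trans (ler_norm_sum _ _ _) _.
rewrite -sum1_card natr_sum [leRHS]big_mkcond; apply: ler_sum => x _.
rewrite normrM /chi normrX normrN1 expr1n mul1r inE.
by case: (Psi x); rewrite ?normr1 ?normr0.
Qed.

(** Under the product measure that keeps each element of S with probability r,
    every subset of at most r #|S| elements has probability at least
    exp (- #|S| h(r)), because r <= 1 - r. *)
Lemma card_small_subsets (R : realType) (T : finType) (S : {set T}) (r : R) :
  0 < r <= 1 / 2 ->
  #|[set Y : {set T} | (Y \subset S) && (#|Y|%:R <= r * #|S|%:R)]%SET|%:R
    <= expR (#|S|%:R * entropy r).
Proof.
move=> /andP[r0 r2]; set n := #|S|; set F := [set Y : {set T} | _]%SET.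
have r1 : 0 < 1 - r by lra.
(* The product measure has total mass 1; the factors F1 and F2 extend it to all
   subsets of T by giving mass 0 to those not contained in S. *)
have tot : \sum_(Y : {set T} | Y \subset S) r ^+ #|Y| * (1 - r) ^+ (n - #|Y|) = 1.
  pose F1 s : R := if s \in S then r else 0.
  pose F2 s : R := if s \in S then 1 - r else 1.
  have := @bigA_distr R 0 1 *%R +%R T F1 F2.
  rewrite [LHS]big1 => [E|s _]; last first.
    by rewrite /= /F1 /F2; case: ifP => _; ring.
  rewrite [RHS]E.
  rewrite big_mkcond; apply: eq_bigr => Y _; case: ifP => YS.
    rewrite (bigID (mem S)) /= [X in _ = _ * X]big1 ?mulr1; last first.
      move=> s sS; rewrite /F1 /F2 (negbTE sS) ifN//.
      by apply: contra sS; apply: (fintype.subsetP YS).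
    rewrite (bigID (mem Y)) /=; congr (_ * _).
      rewrite (eq_bigl (fun s => s \in Y)) => [|s]; last first.
        by rewrite /= andbC; case: (boolP (s \in Y)) => //= /(fintype.subsetP YS) ->.
      rewrite (eq_bigr (fun=> r)) ?prodr_const// => s sY.
      by rewrite sY /F1 (fintype.subsetP YS).
    rewrite (eq_bigl (fun s => s \in S :\: Y)%SET) => [|s]; last by rewrite /= inE andbC.
    rewrite (eq_bigr (fun=> 1 - r)) => [|s]; last first.
      by rewrite /= inE => /andP[sY sS]; rewrite (negbTE sY) /F2 sS.
    by rewrite prodr_const cardsD (finset.setIidPr YS).
  have /fintype.subsetPn[s sY sS] := negbT YS.
  by rewrite (bigD1 s)//= sY /F1 (negbTE sS) mul0r.
have low (Y : {set T}) : Y \in F ->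
    expR (- (n%:R * entropy r)) <= r ^+ #|Y| * (1 - r) ^+ (n - #|Y|).
  rewrite inE => /andP[YS Yr]; have Yn : (#|Y| <= n)%N by exact: subset_leq_card.
  have expE (x : R) j : 0 < x -> x ^+ j = expR (j%:R * ln x).
    by move=> x0; rewrite expRM_natl lnK.
  rewrite !expE// -expRD ler_expR natrB// /entropy /xlnx.
  have lnr : ln r <= ln (1 - r) by rewrite ler_ln ?posrE//; lra.
  have : (r * n%:R - #|Y|%:R) * ln r <= (r * n%:R - #|Y|%:R) * ln (1 - r).
    by rewrite ler_wpM2l// subr_ge0.
  by lra.
rewrite -[X in _ <= X]mul1r -ler_pdivrMr ?expR_gt0// -expRN.
rewrite [leLHS]mulr_natl -sumr_const -[leRHS]tot.
apply: le_trans (ler_sum _ low) _.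
rewrite [leLHS]big_mkcond [leRHS]big_mkcond; apply: ler_sum => Y _; rewrite inE.
have H : 0 <= r ^+ #|Y| * (1 - r) ^+ (n - #|Y|) by rewrite mulr_ge0 ?exprn_ge0 ?ltW.
by case: (Y \subset S) => //=; case: ifP.
Qed.

(** * A near-eigenfunction of small support *)

Definition tent (R : realType) (L c x : R) : R := Num.max 0 (L - `|x - c|).

Lemma tent_ge0 (R : realType) (L c x : R) : 0 <= tent L c x.
Proof. by rewrite le_max lexx. Qed.

(** A tent is linear, hence harmonic, away from its peak and convex at the ends of
    its support; the peak costs a factor 1 - 1/L. *)
Lemma tent_neighbours (R : realType) (L c x : R) : 1 <= L ->
  2 * (1 - L^-1) * tent L c x <= tent L c (x - 1) + tent L c (x + 1).
Proof.
move=> L1.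
have [x0|x0] := leP (L - `|x - c|) 0.
  by rewrite /tent (max_l x0) mulr0 addr_ge0 ?tent_ge0.
have t1 y : L - `|y - c| <= tent L c y by rewrite le_max lexx orbT.
rewrite {1}/tent (max_r (ltW x0)).
have := t1 (x - 1); have := t1 (x + 1).
have LE : 2 * (1 - L^-1) * (L - `|x - c|) = 2 * (L - 1) - 2 * `|x - c| + 2 * (`|x - c| / L).
  by field; field_side.
have L2 : `|x - c| / L <= 1 by rewrite ler_pdivrMr; lra.
have L3 : 0 <= `|x - c| / L by rewrite divr_ge0//; lra.
have L4 : `|x - c| / L <= `|x - c| by rewrite ler_pdivrMr ?ler_peMr//; lra.
rewrite LE.
have : `|x - 1 - c| + `|x + 1 - c| <= 2 + 2 * `|x - c| - 2 * (`|x - c| / L).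
  move: L2 L3 L4; set u := `|x - c| / L; clearbody u.
  case: (ger0P (x - c)); case: (ger0P (x - 1 - c)); case: (ger0P (x + 1 - c)); lra.
lra.
Qed.

(** On the levels near r n, multiplying by s^j with s^2 = r / (1 - r) balances the
    two transition rates j / s and (n - j) s of the cube, which both become close
    to n sqrt (r (1 - r)).  The tent has half-width L and ends at r n, so that over
    its support the rates are at least n sqrt (r (1 - r)) - 2 L / s. *)
Definition geometric_tent (R : realType) (r L : R) (n j : nat) : R :=
  Num.sqrt (r / (1 - r)) ^+ j * tent L (r * n%:R - L) j%:R.

Lemma geometric_tent_neighbours (R : realType) (r L : R) (n j : nat)
    (s := Num.sqrt (r / (1 - r))) (q := Num.sqrt (r * (1 - r))) :
  0 < r <= 1 / 2 -> 1 <= L -> 2 * L <= r * n%:R -> (j <= n)%N ->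
  2 * (1 - L^-1) * (n%:R * q - 2 * L / s) * geometric_tent r L n j
   <= j%:R * geometric_tent r L n j.-1 + (n%:R - j%:R) * geometric_tent r L n j.+1.
Proof.
move=> /andP[r0 r2] L1 rL jn.
have s0 : 0 < s by rewrite sqrtr_gt0 divr_gt0//; lra.
have q0 : 0 < q by rewrite sqrtr_gt0 mulr_gt0//; lra.
have qE : q = r / s.
  apply: (mulIf (lt0r_neq0 s0)); rewrite divfK ?gt_eqF// /q /s -sqrtrM; last first.
    by rewrite mulr_ge0//; lra.
  have -> : r * (1 - r) * (r / (1 - r)) = r ^+ 2 by field; field_side.
  by rewrite sqrtr_sqr ger0_norm// ltW.
have qE' : q = (1 - r) * s.
  have s2 : s ^+ 2 = r / (1 - r) by rewrite sqr_sqrtr// divr_ge0//; lra.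
  apply: (mulIf (lt0r_neq0 s0)); rewrite -mulrA -expr2 s2 qE divfK ?gt_eqF//.
  by field; field_side.
rewrite /geometric_tent -/s; set c := r * n%:R - L.
set mu := n%:R * q - 2 * L / s.
have muE : mu = (r * n%:R - 2 * L) / s by rewrite /mu qE; field; field_side.
have mu0 : 0 <= mu by rewrite muE divr_ge0 ?subr_ge0// ltW.
have [tj|tj] := eqVneq (tent L c j%:R) 0.
  rewrite tj !mulr0; apply: addr_ge0; apply: mulr_ge0 => //.
  - by rewrite mulr_ge0 ?exprn_ge0 ?tent_ge0// ltW.
  - by rewrite subr_ge0 ler_nat.
  - by rewrite mulr_ge0 ?exprn_ge0 ?tent_ge0// ltW.
have : `|j%:R - c| < L.
  rewrite ltNge; apply: contra tj => H; rewrite /tent max_l//; lra.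
rewrite ltr_norml => /andP[jc1 jc2].
have jlow : mu <= j%:R / s.
  by rewrite muE ler_pM2r ?invr_gt0//; rewrite /c in jc1; lra.
have jhigh : mu <= (n%:R - j%:R) * s.
  have : n%:R * q <= (n%:R - j%:R) * s.
    by rewrite qE' mulrA ler_pM2r//; rewrite /c in jc2; lra.
  have : 0 <= 2 * L / s by rewrite divr_ge0//; lra.
  by rewrite /mu; lra.
have E1 : s ^+ j * (mu * tent L c (j%:R - 1)) <= j%:R * (s ^+ j.-1 * tent L c j.-1%:R).
  (* For j = 0 the left-hand side involves the tent at -1, but then mu vanishes. *)
  case: j jlow {jn tj jc1 jc2 jhigh} => [|j] jlow.
    have -> : mu = 0 by apply/eqP; rewrite eq_le mu0 andbT; move: jlow; rewrite mul0r.
    by rewrite !mul0r mulr0.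
  rewrite /= -[j.+1%:R - 1]/(j.+1%:R - 1%:R) -natrB// subn1 /=.
  have -> : j.+1%:R * (s ^+ j * tent L c j%:R) = s ^+ j.+1 * (j.+1%:R / s * tent L c j%:R).
    by rewrite exprS; field; field_side.
  by rewrite ler_pM2l ?exprn_gt0// ler_wpM2r ?tent_ge0.
have E2 : s ^+ j * (mu * tent L c (j%:R + 1)) <= (n%:R - j%:R) * (s ^+ j.+1 * tent L c j.+1%:R).
  have -> : (n%:R - j%:R) * (s ^+ j.+1 * tent L c j.+1%:R)
    = s ^+ j * ((n%:R - j%:R) * s * tent L c (j%:R + 1)).
    by rewrite -natr1 exprS; ring.
  by rewrite ler_pM2l ?exprn_gt0// ler_wpM2r ?tent_ge0.
apply: le_trans (lerD E1 E2).
rewrite -mulrDr -mulrDr.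
have -> : 2 * (1 - L^-1) * mu * (s ^+ j * tent L c j%:R) =
  s ^+ j * (mu * (2 * (1 - L^-1) * tent L c j%:R)) by ring.
by rewrite ler_pM2l ?exprn_gt0// ler_wpM2l// tent_neighbours.
Qed.

(** The tent ends at r n, so that only subsets of at most r n elements contribute
    to the support; G is nonzero because the level at the integer part of the
    peak r n - L carries a positive weight. *)
Lemma small_support_test_function (R : realType) (k : nat) (S : {set 'rV['F_2]_k}) (r L : R)
    (n := #|S|) (s := Num.sqrt (r / (1 - r))) (q := Num.sqrt (r * (1 - r))) :
  0 < r <= 1 / 2 -> 1 < L -> 2 * L <= r * n%:R ->
  exists (G : 'rV['F_2]_k -> R) (E : {set 'rV['F_2]_k}),
    [/\ #|E|%:R <= expR (n%:R * entropy r),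
        forall x, x \notin E -> G x = 0,
        forall x, 0 <= G x,
        0 < \sum_x G x ^+ 2 &
        forall x, 2 * (1 - L^-1) * (n%:R * q - 2 * L / s) * G x
                    <= \sum_(y in S) G (x + y)].
Proof.
move=> rr L1 rL; have /andP[r0 r2] := rr.
pose phi := geometric_tent r L n.
have s0 : 0 < s by rewrite sqrtr_gt0 divr_gt0//; lra.
have phi0 j : 0 <= phi j by rewrite mulr_ge0 ?exprn_ge0 ?tent_ge0// ltW.
pose F := [set Y : {set 'rV['F_2]_k} | (Y \subset S) && (#|Y|%:R <= r * n%:R)]%SET.
have G0 x : 0 <= subset_sums S phi x by apply: sumr_ge0.
pose total (Y : {set 'rV['F_2]_k}) := \sum_(y in Y) y.
exists (subset_sums S phi), [set total Y | Y in F]%SET; split => //.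
- apply: le_trans (card_small_subsets S rr).
  by rewrite ler_nat; exact: leq_imset_card.
- move=> x xF; rewrite /subset_sums big1// => Y /andP[YS /eqP Yx].
  have : Y \notin F by apply: contra xF => YF; apply/imsetP; exists Y.
  rewrite inE YS /= -ltNge => H; rewrite /phi /geometric_tent /tent max_l ?mulr0//.
  have : #|Y|%:R - (r * n%:R - L) <= `|#|Y|%:R - (r * n%:R - L)| by exact: ler_norm.
  by lra.
- pose j := Num.truncn (r * n%:R - L).
  have c0 : 0 <= r * n%:R - L by lra.
  have /andP[j1 j2] := truncn_itv c0.
  have jn : (j <= n)%N.
    rewrite -(ler_nat R); apply: le_trans j1 _.
    have : r * n%:R <= 1 * n%:R by rewrite ler_wpM2r//; lra.
    by lra.
  have phij : 0 < phi j.
    rewrite mulr_gt0 ?exprn_gt0// lt_max; apply/orP; right.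
    by rewrite subr_gt0 ltr_norml -/j in j1 j2 *; rewrite -natr1 in j2; lra.
  have [Y [YS Yj]] : exists Y : {set 'rV['F_2]_k}, Y \subset S /\ #|Y| = j.
    have /card_gt0P[Y] : (0 < #|[set Y : {set 'rV['F_2]_k} | Y \subset S & #|Y| == j]%SET|)%N.
      by rewrite cards_draws bin_gt0.
    by rewrite inE => /andP[YS /eqP Yj]; exists Y.
  rewrite (bigD1 (\sum_(y in Y) y))//= ltr_pwDl//; last first.
    by apply: sumr_ge0 => x _; exact: sqr_ge0.
  rewrite exprn_gt0// /subset_sums (bigD1 Y) ?YS ?eqxx//= ltr_pwDl ?Yj//.
  exact: sumr_ge0.
- move=> x; apply: subset_sums_neighbours_ge => j jn.
  by apply: geometric_tent_neighbours => //; exact: ltW.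
Qed.

(** * Inverse entropy and vanishing errors *)

Lemma entropy_gt0 (R : realType) (q : R) : 0 < q < 1 -> 0 < entropy q.
Proof.
move=> /andP[q0 q1]; rewrite /entropy /xlnx.
have : 0 < q * (- ln q) by rewrite mulr_gt0// oppr_gt0 ln_lt0// q0.
have : 0 < (1 - q) * (- ln (1 - q)).
  by rewrite mulr_gt0 ?oppr_gt0 ?ln_lt0//; lra.
by lra.
Qed.

Lemma entropy_half (R : realType) : entropy (2^-1 : R) = ln 2.
Proof.
rewrite /entropy /xlnx (_ : 1 - 2^-1 = 2^-1); last by field.
by rewrite lnV ?posrE//; field.
Qed.

Lemma ln2_gt0 (R : realType) : 0 < ln (2 : R).
Proof. by rewrite ln_gt0//; lra. Qed.

(** The intermediate value theorem is applied on [e, 1/2], where e > 0 is so small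
    that [entropy_le_sqrt] gives entropy e <= v; this avoids the logarithm at 0. *)
Lemma entropy_surj (R : realType) (v : R) : 0 < v <= ln 2 ->
  exists2 x, 0 < x <= 2^-1 & entropy x = v.
Proof.
move=> /andP[v0 v2]; pose e := (v / 3) ^+ 2.
have l2 : ln (2 : R) < 2 by rewrite ln_sublinear.
have e0 : 0 < e by rewrite exprn_gt0// divr_gt0.
have e2 : e <= 2^-1.
  have : e <= (2 / 3) ^+ 2 by rewrite lerXn2r ?nnegrE//; lra.
  by lra.
have ev : entropy e <= v.
  have e01 : 0 < e < 1 by rewrite e0; lra.
  apply: le_trans (entropy_le_sqrt e01) _.
  by rewrite sqrtr_sqr ger0_norm//; lra.
have cont : {within `[e, 2^-1], continuous (@entropy R)}.
  apply: derivable_within_continuous => x; rewrite in_itv /= => /andP[xe x2].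
  have x0 : 0 < x by lra.
  have y0 : 0 < 1 - x by lra.
  have ? := is_derive1_ln x0.
  have H := is_derive1_ln y0.
  have ? : is_derive x 1 (fun x : R => 1 - x) (-1).
    by apply: is_derive_eq; rewrite ?scaler1 ?add0r ?oppr0 ?sub0r; ring.
  have ? : is_derive x 1 (fun x : R => ln (1 - x)) ((1 - x)^-1 * -1).
    exact: (@is_derive1_comp _ (@ln R) (fun x : R => 1 - x)).
  have : is_derive x 1 (fun x : R => - (x * ln x) - (1 - x) * ln (1 - x)) (ln (1 - x) - ln x).
    by apply: is_derive_eq; rewrite /GRing.scale /=; field; field_side.
  by move=> ?; exact: ex_derive.
have vb : Num.min (entropy e) (entropy 2^-1) <= v <= Num.max (entropy e) (entropy 2^-1).
  by rewrite entropy_half ge_min ev le_max v2 orbT.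
have [x] := IVT e2 cont vb.
rewrite in_itv /= => /andP[xe x2] xv; exists x => //.
by rewrite x2 andbT; lra.
Qed.

Lemma h2invP (R : realType) (y : R) : 0 < y <= 1 ->
  0 < h2inv y <= 1 / 2 /\ entropy (h2inv y) = y * ln 2.
Proof.
move=> /andP[y0 y1]; have l2 := ln2_gt0 R.
have [|x /andP[x0 x2] xy] := @entropy_surj R (y * ln 2).
  by rewrite mulr_gt0// ler_piMl// ltW.
have hx : h2 x = y by apply: (mulIf (lt0r_neq0 l2)); rewrite -entropyE.
have yin : ([set` `[0, 2^-1]] : set R) x by rewrite /= in_itv /= x2 ltW.
have him : y \in (@h2 R) @` `[0, 2^-1] by rewrite inE; exists x.
have hK : h2 (h2inv y) = y by rewrite /h2inv pinvK.
have hin : `[0, 2^-1]%classic (h2inv y).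
  have sj : set_surj `[0, 2^-1] ((@h2 R) @` `[0, 2^-1]) (@h2 R) by [].
  by apply: (surjpinv_image_sub (dflt := fun=> 0) sj); exists y => //; exists x.
move: hin; rewrite /= in_itv /= => /andP[h0 hh].
split; last by rewrite entropyE hK.
rewrite div1r hh andbT lt_neqAle h0 andbT; apply/eqP => E0.
(* h2 vanishes at 0, and y does not. *)
move: hK; rewrite -E0 /h2 /log2 subr0 ln1 !mul0r oppr0 !mul0r mulr0 subr0 => E.
by rewrite -E ltxx in y0.
Qed.

(** The error delta k is the best nonpositive admissible one, up to 1 / (k + 1)
    since the supremum need not be admissible. *)
Lemma vanishing_error (R : realType) (P : nat -> R -> Prop) :
  (forall k d d', d' <= d -> P k d -> P k d') ->
  (forall k, exists d, P k d) ->
  (forall e : R, 0 < e -> exists K, forall k, (K <= k)%N -> P k (- e)) ->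
  exists delta : nat -> R,
    (delta k @[k --> \oo] --> (0 : R)) /\ forall k, P k (delta k).
Proof.
move=> anti ex ev; pose A k := [set d : R | d <= 0 /\ P k d].
have A0 k : A k !=set0.
  have [d Pd] := ex k; exists (Num.min d 0); split; first by rewrite ge_min lexx orbT.
  by apply: anti Pd; rewrite ge_min lexx.
have Aub k : ubound (A k) 0 by move=> d [].
have As k : has_sup (A k) by split; [exact: A0|exists 0; exact: Aub].
pose delta k : R := sup (A k) - k.+1%:R^-1.
exists delta; split; last first.
  move=> k; have k0 : 0 < k.+1%:R^-1 :> R by rewrite invr_gt0.
  have [d [_ Pd] dk] := sup_adherent k0 (As k).
  exact: anti (ltW dk) Pd.
apply/cvgrPdist_le => e e0.
have e2 : 0 < e / 2 by lra.
have [K HK] := ev _ e2.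
near=> k.
have kK : (K <= k)%N by near: k; exact: nbhs_infty_ge.
have sup0 : sup (A k) <= 0 by apply: ge_sup.
have supe : - (e / 2) <= sup (A k).
  by apply: ub_le_sup; [exists 0; exact: Aub|split; [lra|exact: HK]].
have kb : k.+1%:R^-1 <= e / 2.
  rewrite -[leRHS]invrK lef_pV2 ?posrE ?invr_gt0//.
  apply: le_trans (ltW (truncnS_gt _)) _.
  rewrite ler_nat ltnS; near: k; exact: nbhs_infty_ge.
have kb0 : 0 <= k.+1%:R^-1 :> R by rewrite invr_ge0.
rewrite sub0r normrN ler_norml /delta.
have close (x y z : R) : 0 < z -> x <= 0 -> - (z / 2) <= x -> 0 <= y -> y <= z / 2 ->
  - z <= x - y <= z by move=> *; apply/andP; split; lra.
exact: close.
Unshelve. all: by end_near.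
Qed.

(** Since ln (k + 1) <= 2 sqrt (k + 1), it suffices that k exceeds a multiple of
    B^2. *)
Lemma log_le_linear (R : realType) (B : R) : 0 <= B ->
  exists K, forall k, (K <= k)%N -> B * ln k.+1%:R <= k%:R.
Proof.
move=> B0; exists (Num.truncn (8 * B ^+ 2)).+1 => k kK.
have k1 : 1 <= k%:R :> R by rewrite ler1n (leq_ltn_trans _ kK).
have kB : 8 * B ^+ 2 <= k%:R.
  by apply: le_trans (ltW (truncnS_gt _)) _; rewrite ler_nat.
pose t := Num.sqrt (k.+1%:R : R).
have t0 : 0 < t by rewrite sqrtr_gt0.
have t2 : t ^+ 2 = k%:R + 1 by rewrite sqr_sqrtr// natr1.
have -> : k.+1%:R = t ^+ 2 :> R by rewrite t2 natr1.
rewrite lnXn// mulr2n.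
have lt : ln t <= t by rewrite ltW// ln_sublinear.
have H : B * ln t <= B * t by rewrite ler_wpM2l.
have Bt : B * t * 2 <= k%:R.
  rewrite -ler_sqr ?nnegrE ?mulr_ge0 ?(ltW t0)// !exprMn t2.
  have : B ^+ 2 * (k%:R + 1) * 8 <= k%:R * (2 * k%:R).
    rewrite mulrAC; apply: ler_pM; rewrite ?mulr_ge0 ?sqr_ge0//; lra.
  lra.
lra.
Qed.

(** * Comparison of the two spectral estimates *)

(** The average of hat Psi against the Fourier mass of G is at least lam.  On the
    frequencies of weight at least t it is at most M; on the others
    hat Psi <= n <= M + 2 n, and they carry at most a fraction eta of the mass. *)
Lemma frequency_cutoff_bound (R : realType) (k : nat) (Psi : 'rV['F_2]_k -> bool)
    (G : 'rV['F_2]_k -> R) (n := #|supp Psi|) (lam M eta t : R) :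
  0 < \sum_x G x ^+ 2 -> (forall x, 0 <= G x) ->
  (forall x, lam * G x <= \sum_(s in supp Psi) G (x + s)) ->
  \sum_(w | 2 * (k%:R - t) <= 2 * (k%:R - (hweight w)%:R)) fourier G w ^+ 2
    <= eta * \sum_w fourier G w ^+ 2 ->
  - n%:R <= M ->
  (forall w, t <= (hweight w)%:R -> fourier (fun x => (Psi x)%:R) w <= M) ->
  lam <= M + 2 * n%:R * eta.
Proof.
move=> GG G0 lamG low Mn HM.
have p2 : 0 < 2 ^+ k :> R by rewrite exprn_gt0.
have SE : \sum_w fourier G w ^+ 2 = 2 ^+ k * \sum_x G x ^+ 2.
  by rewrite -[in RHS](eq_bigr _ (fun x _ => esym (expr2 (G x)))) -parseval.
have S0 : 0 < \sum_w fourier G w ^+ 2 by rewrite SE mulr_gt0.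
rewrite -(ler_pM2r S0).
have H1 : lam * \sum_w fourier G w ^+ 2 <=
   \sum_w fourier (fun x => (Psi x)%:R) w * fourier G w ^+ 2.
  rewrite sum_fourier_set SE mulrCA ler_pM2l// mulr_sumr; apply: ler_sum => x _.
  by rewrite expr2 mulrCA ler_wpM2l.
apply: le_trans H1 _; rewrite mulrDl.
have n0 : 0 <= 2 * n%:R :> R by rewrite mulr_ge0.
apply: (@le_trans _ _ (M * \sum_w fourier G w ^+ 2 + 2 * n%:R *
   \sum_(w | 2 * (k%:R - t) <= 2 * (k%:R - (hweight w)%:R)) fourier G w ^+ 2)); last first.
  by rewrite lerD2l -[leRHS]mulrA ler_wpM2l.
rewrite mulr_sumr mulr_sumr [X in _ + X]big_mkcond -big_split /=.
apply: ler_sum => w _; have g0 := sqr_ge0 (fourier G w).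
have [tw|tw] := leP t (hweight w)%:R.
  have H := ler_wpM2r g0 (HM w tw).
  by case: ifP => _; rewrite ?addr0//; apply: le_trans H _; rewrite lerDl mulr_ge0.
rewrite ifT; last by lra.
rewrite -mulrDl ler_wpM2r//.
have := fourier_set_le R Psi w; rewrite ler_norml -/n => /andP[_ H].
by lra.
Qed.

Lemma expr_eventually_le (R : realType) (x e : R) : 0 <= x < 1 -> 0 < e ->
  exists m, x ^+ m <= e.
Proof.
move=> /andP[x0 x1] e0; have nx : `|x| < 1 by rewrite ger0_norm.
have /cvgrPdist_le /(_ e e0) [m _ /(_ m (leqnn m))] := cvg_expr nx.
by rewrite sub0r normrN ger0_norm ?exprn_ge0// => H; exists m.
Qed.

Lemma hweight_ones (k : nat) : hweight (const_mx 1 : 'rV['F_2]_k) = k.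
Proof.
rewrite /hweight (_ : [set j | _]%SET = [set: 'I_k]%SET) ?cardsT ?card_ord//.
by apply/setP => j; rewrite !inE mxE.
Qed.

(** * The uniform asymptotic bound *)

(** The parameters are chosen in the order m, L, k: first m makes the
    low-frequency fraction small, then L makes the peak of the tent cheap, and
    then k makes the boundary effects of the tent and the factor (k + 1)^m of the
    support size negligible.  These choices depend only on e, tau, rho1' and
    rho2', because rho1 is bounded below in terms of tau and rho1'. *)
Lemma high_frequency_lower_bound (R : realType) (tau rho1' rho2' : R) :
  0 < tau -> 0 < rho1' < 1 / 2 -> 0 < rho2' < 1 / 2 ->
  1 < (1 - 2 * rho1') ^+ 2 + (1 - 2 * rho2') ^+ 2 ->
  forall e : R, 0 < e -> exists K, forall k, (K <= k)%N ->
  forall (n : nat) (Psi : 'rV['F_2]_k -> bool), (0 < k)%N -> #|supp Psi| = n ->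
    tau * k%:R <= n%:R <= k%:R / tau -> h2 rho1' * (k%:R / n%:R) <= 1 ->
    let rho1 := h2inv (h2 rho1' * (k%:R / n%:R)) in
    exists2 w, rho2' * k%:R <= (hweight w)%:R &
      n%:R * (2 * Num.sqrt (rho1 * (1 - rho1)) - e)
        <= fourier (fun x => (Psi x)%:R) w.
Proof.
move=> tau0 r1b r2b cond e e0.
have [c c0 two] := two_point_log_sobolev r1b.
have /andP[r10 r12] := r1b; have /andP[r20 r22] := r2b.
pose a : R := 2 * Num.sqrt (rho1' * (1 - rho1')).
pose H : R := entropy rho1'.
pose be : R := 2 * (1 - rho2').
have H0 : 0 < H by apply: entropy_gt0; rewrite r10; lra.
have a0 : 0 <= a by rewrite mulr_ge0.
have a2 : a ^+ 2 = 1 - (1 - 2 * rho1') ^+ 2.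
  rewrite exprMn sqr_sqrtr; first by ring.
  by rewrite mulr_ge0//; lra.
have abe : 1 + a < be.
  have : a < 1 - 2 * rho2'.
    by rewrite -ltr_sqr ?nnegrE//; lra.
  by rewrite /be; lra.
(* k (1 + a) bounds the Rayleigh quotient of G up to lower-order terms and k be is
   the eigenvalue of the lazy walk at weight rho2' k; g lies strictly between. *)
pose g : R := (1 + a + be) / 2.
have ag : 1 + a < g by rewrite /g; lra.
have gb : g < be by rewrite /g; lra.
have g0 : 0 < g by lra.
have be0 : 0 < be by lra.
pose D : R := g / (be - g).
have D0 : 0 < D by rewrite divr_gt0//; lra.
have [m Hm] : exists m, ((g / be) ^+ 2) ^+ m <= e / (6 * D).
  apply: expr_eventually_le; last by rewrite divr_gt0// mulr_gt0.
  have x0 : 0 <= g / be by rewrite divr_ge0// ltW.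
  by rewrite sqr_ge0 /= expr_lt1// ltr_pdivrMr// mul1r.
pose L : R := 1 + 3 / e.
have L1 : 1 < L by rewrite ltrDl divr_gt0.
have Le : L^-1 <= e / 3.
  rewrite -[e / 3]invrK lef_pV2 ?posrE ?invr_gt0//; [|lra|by rewrite divr_gt0].
  by rewrite invf_div /L; lra.
(* A lower bound for sqrt rho1, hence for sqrt (rho1 / (1 - rho1)): the entropy of
   rho1 is H k / n >= H tau, and it is at most 3 sqrt rho1. *)
pose sg : R := H * tau / 3.
have sg0 : 0 < sg by rewrite divr_gt0// mulr_gt0.
have [K3 HK3] : exists K, forall k, (K <= k)%N ->
    c * m%:R / (g - 1 - a) * ln k.+1%:R <= k%:R.
  by apply: log_le_linear; rewrite divr_ge0// ?mulr_ge0//; lra.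
pose K1 := (Num.truncn (2 * L / (tau * sg ^+ 2))).+1.
pose K2 := (Num.truncn (12 * L / (tau * sg * e))).+1.
exists (maxn K1 (maxn K2 K3)) => k; rewrite !geq_max => /and3P[kK1 kK2 /HK3 {HK3}kK3].
have {}kK1 : 2 * L <= tau * sg ^+ 2 * k%:R.
  rewrite -ler_pdivrMl ?mulr_gt0 ?exprn_gt0// mulrC.
  by apply: le_trans (ltW (truncnS_gt _)) _; rewrite ler_nat.
have {}kK2 : 12 * L <= tau * sg * e * k%:R.
  rewrite -ler_pdivrMl ?mulr_gt0// mulrC.
  by apply: le_trans (ltW (truncnS_gt _)) _; rewrite ler_nat.
have {}kK3 : c * m%:R * ln k.+1%:R <= (g - 1 - a) * k%:R.
  rewrite -ler_pdivrMl; last by lra.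
  by rewrite mulrC mulrAC.
move=> n Psi k0 cn /andP[n1 n2] hle r.
have k0' : 0 < k%:R :> R by rewrite ltr0n.
have n0 : 0 < n%:R :> R by apply: lt_le_trans n1; rewrite mulr_gt0.
have hr0 : 0 < h2 rho1'.
  by rewrite -(pmulr_lgt0 _ (ln2_gt0 R)) -entropyE.
have [rb rE] : 0 < r <= 1 / 2 /\ entropy r = h2 rho1' * (k%:R / n%:R) * ln 2.
  by apply: h2invP; rewrite hle andbT mulr_gt0// divr_gt0.
have {}rE : n%:R * entropy r = k%:R * H.
  by rewrite rE /H entropyE; field; field_side.
have /andP[r0 r2] := rb.
have sgr : sg <= Num.sqrt r.
  have r01 : 0 < r < 1 by rewrite r0; lra.
  have := entropy_le_sqrt r01.
  have : H * tau <= entropy r.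
    rewrite -(ler_pM2l n0) rE mulrCA mulrC ler_pM2r//.
    by rewrite -ler_pdivlMr.
  by rewrite /sg; lra.
have rn : 2 * L <= r * n%:R.
  apply: le_trans kK1 _.
  have : sg ^+ 2 <= r.
    by rewrite -[leRHS]sqr_sqrtr ?(ltW r0)// lerXn2r ?nnegrE ?sqrtr_ge0// ltW.
  move=> sr; rewrite mulrAC mulrC; apply: ler_pM => //; first exact: sqr_ge0.
  by rewrite mulr_ge0// ltW.
have := @small_support_test_function R k (supp Psi) r L rb L1; rewrite cn => /(_ rn).
set s := Num.sqrt (r / (1 - r)); set q := Num.sqrt (r * (1 - r)).
move=> [G [E [cE GE G0 GG lamG]]].
have q12 : q <= 1 / 2.
  have -> : 1 / 2 = Num.sqrt ((1 / 2) ^+ 2) :> R by rewrite sqrtr_sqr ger0_norm//; lra.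
  apply: ler_wsqrtr; have := sqr_ge0 (r - 1 / 2).
  by lra.
have sgs : sg <= s.
  apply: le_trans sgr _; apply: ler_wsqrtr.
  rewrite ler_pdivlMr; last by lra.
  by rewrite ler_piMr//; lra.
have lnE : ln (#|E| * k.+1 ^ m)%:R <= k%:R * H + m%:R * ln k.+1%:R.
  have p0 : 0 < (k.+1 ^ m)%:R :> R by rewrite ltr0n expn_gt0.
  have lk : 0 <= ln k.+1%:R :> R by rewrite ln_ge0// ler1n.
  case: (posnP #|E|) cE => [->|E0] cE.
    by rewrite mul0n ln0// addr_ge0// mulr_ge0// ltW.
  rewrite natrM lnM ?posrE ?ltr0n ?expn_gt0// natrX lnXn// -[ln _ *+ m]mulr_natl.
  rewrite lerD2r -rE.
  by rewrite -[leRHS]expRK ler_ln ?posrE ?expR_gt0 ?ltr0n.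
(* With this b the terms in H = entropy rho1' cancel: k (1 + b) + c k H = k (1 + a). *)
pose b := a - c * H.
have lowE := @low_frequency_mass R b c (g * k%:R) (be * k%:R) k m G E (ltW c0) two GE.
have {}lowE : \sum_(w | 2 * (k%:R - rho2' * k%:R) <= 2 * (k%:R - (hweight w)%:R))
     fourier G w ^+ 2 <= ((g / be) ^+ 2) ^+ m * D * \sum_w fourier G w ^+ 2.
  have : be * k%:R = 2 * (k%:R - rho2' * k%:R) by rewrite /be; ring.
  move=> beE; rewrite -beE.
  have P0 : 0 < (be * k%:R) ^+ (2 * m) * (be * k%:R - g * k%:R).
    by apply: mulr_gt0; [apply: exprn_gt0; apply: mulr_gt0|rewrite subr_gt0 ltr_pM2r].
  rewrite -(ler_pM2l P0); apply: le_trans (lowE _ _) _.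
  - by rewrite mulr_ge0 ?(ltW g0)//= ltr_pM2r.
  - have := ler_wpM2l (ltW c0) lnE; rewrite /b.
    by lra.
  rewrite mulrA le_eqVlt; apply/orP; left; apply/eqP; congr (_ * _).
  have scale (x y z : R) : 0 < y - x -> 0 < y -> 0 < z -> (x * z) ^+ (2 * m).+1 =
      (y * z) ^+ (2 * m) * (y * z - x * z) * (((x / y) ^+ 2) ^+ m * (x / (y - x))).
    move=> yx y0 z0; rewrite exprS -exprM !exprMn exprVn.
    have : y ^+ (2 * m) != 0 by rewrite expf_neq0// gt_eqF.
    move: (x ^+ _) (y ^+ _) (z ^+ _) => x' y' z' y'0.
    by field; rewrite y'0 andbT; field_side.
  by apply: scale => //; rewrite subr_gt0.
pose t := rho2' * k%:R.
have ones : t <= (hweight (const_mx 1 : 'rV['F_2]_k))%:R.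
  by rewrite hweight_ones /t ler_piMl//; lra.
pose F (w : 'rV['F_2]_k) : R := fourier (fun x => (Psi x)%:R) w.
case: (@arg_maxP _ _ _ (const_mx 1) (fun w => t <= (hweight w)%:R) F ones) => w tw wmax.
exists w => //.
have := frequency_cutoff_bound GG G0 lamG lowE _ wmax.
rewrite cn => /(_ _)/wrap[].
  by have := fourier_set_le R Psi w; rewrite cn ler_norml => /andP[].
rewrite -/(F w) => H1.
have s0 : 0 < s by lra.
have L0 : 0 < L by lra.
have Li0 : 0 < L^-1 by rewrite invr_gt0.
(* Each of the three losses, from the low frequencies, from the peak of the tent
   and from the variation of the rates over its support, is at most n e / 3. *)
have T1 : n%:R * ((g / be) ^+ 2) ^+ m * D <= n%:R * (e / 6).
  rewrite -mulrA ler_pM2l//; have := ler_wpM2r (ltW D0) Hm.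
  by have -> : e / (6 * D) * D = e / 6 by field; field_side.
have T2 : n%:R * L^-1 <= n%:R * (e / 3) by rewrite ler_pM2l.
have T3 : 4 * L / s <= n%:R * (e / 3).
  rewrite ler_pdivrMr//.
  have : tau * k%:R * (sg * e) <= n%:R * (s * e).
    by apply: ler_pM => //; rewrite ?ler_pM2r// mulr_ge0// ltW.
  by lra.
have T4 : n%:R * L^-1 * q <= n%:R * L^-1 * (1 / 2) by rewrite ler_pM2l// mulr_gt0.
have T5 : 0 <= L^-1 * (L / s) by rewrite mulr_ge0 ?divr_ge0// ltW.
by lra.
Qed.

(** * Maximal Fourier coefficient *)

Theorem theorem15 (R : realType) (tau rho1' rho2' : R)
    (tau_gt0 : 0 < tau)
    (rho1'_bounds : 0 < rho1' < 1 / 2) (rho2'_bounds : 0 < rho2' < 1 / 2)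
    (rho_cond : 1 < (1 - 2 * rho1') ^+ 2 + (1 - 2 * rho2') ^+ 2) :
  exists delta : nat -> R,
    (delta k @[k --> \oo] --> (0 : R)) /\
    forall (k n : nat) (Psi : 'rV['F_2]_k -> bool),
      (0 < k)%N ->
      #|supp Psi| = n ->
      tau * k%:R <= n%:R <= k%:R / tau ->
      h2 rho1' * (k%:R / n%:R) <= 1 ->
      let rho1 := h2inv (h2 rho1' * (k%:R / n%:R)) in
      ((n%:R * (2 * Num.sqrt (rho1 * (1 - rho1)) + delta k))%:E
        <= max_fourier_above Psi (rho2' * k%:R))%E.
Proof.
pose P k (d : R) := forall (n : nat) (Psi : 'rV['F_2]_k -> bool),
  (0 < k)%N -> #|supp Psi| = n -> tau * k%:R <= n%:R <= k%:R / tau ->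
  h2 rho1' * (k%:R / n%:R) <= 1 ->
  let rho1 := h2inv (h2 rho1' * (k%:R / n%:R)) in
  ((n%:R * (2 * Num.sqrt (rho1 * (1 - rho1)) + d))%:E
        <= max_fourier_above Psi (rho2' * k%:R))%E.
have [|||delta [d0 dP]] := @vanishing_error R P.
- move=> k d d' dd Pd n Psi k0 cn nb hle; move: (Pd n Psi k0 cn nb hle) => /=.
  set rho1 := h2inv _.
  apply: le_trans.
  by rewrite lee_fin ler_wpM2l// lerD2l.
(* For an arbitrary k the frequency of full weight satisfies a trivial bound. *)
- move=> k; exists (- 3) => n Psi k0 cn nb hle /=; set rho1 := h2inv _.
  have ones : rho2' * k%:R <= (hweight (const_mx 1 : 'rV['F_2]_k))%:R.
    by rewrite hweight_ones ler_piMl//; case/andP: rho2'_bounds => _; lra.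
  apply: le_trans (le_bigmax_cond _ _ ones); rewrite lee_fin.
  have := fourier_set_le R Psi (const_mx 1); rewrite cn ler_norml => /andP[+ _].
  apply: le_trans; rewrite -[leRHS]mulrN1 ler_wpM2l//.
  have : Num.sqrt (rho1 * (1 - rho1)) <= 1.
    rewrite -[leRHS]sqrtr1; apply: ler_wsqrtr.
    by have := sqr_ge0 (rho1 - 1 / 2); lra.
  by lra.
- move=> e e0.
  have [K HK] := high_frequency_lower_bound tau_gt0 rho1'_bounds rho2'_bounds rho_cond e0.
  exists K => k kK n Psi k0 cn nb hle /=.
  have [w tw Hw] := HK k kK n Psi k0 cn nb hle.
  by apply: le_trans (le_bigmax_cond _ _ tw); rewrite lee_fin.
by exists delta; split => // k n Psi; exact: dP.
Qed.
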